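(* Let $k \ge 2$ and $n \ge 3k-1$ be integers. Then the strong metric dimension of the Kneser graph $K_{n,k}$ is $\beta_S(K_{n,k}) = \binom{n}{k} - \lfloor n/k \rfloor$.
   Context: The Kneser graph $K_{n,k}$ has as vertices all $k$-element subsets of $[n]=\{1,\dots,n\}$, two being adjacent iff they are disjoint; $d$ denotes shortest-path distance. A vertex $w$ strongly resolves vertices $u,v$ if $d(v,w)=d(v,u)+d(u,w)$ or $d(u,w)=d(u,v)+d(v,w)$. A set $S$ of vertices is a strong resolving set if every pair of distinct vertices is strongly resolved by some vertex of $S$; $\beta_S(G)$ is the minimum cardinality of a strong resolving set of $G$. *)

(* Defs.v *)
From mathcomp Require Import all_boot.
Set Implicit Arguments.
Unset Strict Implicit.
Unset Printing Implicit Defensive.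

Section GraphDistance.

Variables (T : finType) (e : rel T).
Implicit Types (u v w : T) (S : {set T}).

Definition has_walk m u v :=
  [exists p : m.-tuple T, path e u p && (last u p == v)].

(* A shortest path has fewer than #|T| edges, so the search range is large
   enough; vertices in different components get the out-of-range value #|T|. *)
Definition dist u v : nat := find (fun m => has_walk m u v) (iota 0 #|T|).

Definition strongly_resolves w u v : bool :=
  (dist v w == dist v u + dist u w) || (dist u w == dist u v + dist v w).

Definition strong_resolving_set S : bool :=
  [forall u, forall v, (u != v) ==> [exists w in S, strongly_resolves w u v]].

(* The default [set: T] of the arg min is always strong resolving: see
   strong_resolving_setT below. *)
Definition strong_metric_dim : nat :=
  #|[arg min_(S < [set: T] | strong_resolving_set S) #|S| ]|.

Lemma has_walkP m u v :
  reflect (exists p, [/\ path e u p, last u p = v & size p = m])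
          (has_walk m u v).
Proof.
apply: (iffP existsP) => [[p /andP[ep /eqP lp]]|[p [ep lp sp]]].
  by exists p; rewrite size_tuple.
have sp' : size p == m by apply/eqP.
by exists (Tuple sp'); rewrite /= ep lp eqxx.
Qed.

Lemma dist_min u p : path e u p -> dist u (last u p) <= size p.
Proof.
move=> ep; rewrite /dist; set a := fun m => _.
case: (ltnP (size p) #|T|) => [lt_p|le_p]; last first.
  by apply: leq_trans le_p; rewrite -[X in _ <= X](size_iota 0) find_size.
rewrite leqNgt; apply/negP => /(before_find 0).
rewrite nth_iota // add0n; suff -> : a (size p) by [].
by apply/has_walkP; exists p.
Qed.

Lemma dist_walk u v : connect e u v -> has_walk (dist u v) u v.
Proof.
case/connectP => p /shortenP[q eq uq _] ->.
set v' := last u q.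
have lt_q : size q < #|T|.
  by have := max_card (mem (u :: q)); rewrite (card_uniqP uq).
have hasw : has (fun m => has_walk m u v') (iota 0 #|T|).
  by apply/hasP; exists (size q); rewrite ?mem_iota //; apply/has_walkP; exists q.
have := nth_find 0 hasw; rewrite nth_iota //.
by rewrite -[X in _ < X](size_iota 0) -has_find.
Qed.

Lemma dist0 u : dist u u = 0.
Proof. by apply/eqP; rewrite -leqn0 (@dist_min u [::]). Qed.

Lemma strong_resolving_setT : strong_resolving_set [set: T].
Proof.
apply/forallP => u; apply/forallP => v; apply/implyP => _.
by apply/existsP; exists u; rewrite inE /strongly_resolves dist0 addn0 eqxx.
Qed.

Lemma strong_metric_dimP :
  (exists2 S, strong_resolving_set S & #|S| = strong_metric_dim) /\
  (forall S, strong_resolving_set S -> strong_metric_dim <= #|S|).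
Proof.
rewrite /strong_metric_dim; case: arg_minnP => [|S rS minS].
  exact: strong_resolving_setT.
by split=> //; exists S.
Qed.

End GraphDistance.

Notation kneser_vertex n k := {A : {set 'I_n} | #|A| == k}.

Definition kneser (n k : nat) : rel (kneser_vertex n k) :=
  fun A B => [disjoint val A & val B].
Arguments kneser : clear implicits.

(* Main.v *)
Require Import Defs.
From mathcomp Require Import all_boot zify.
Set Implicit Arguments.
Unset Strict Implicit.
Unset Printing Implicit Defensive.

(** For n >= 3k - 1 the graph has diameter 2: two intersecting k-sets have a
    union of at most 2k - 1 points, hence a common neighbour.  In diameter 2 a
    pair at distance 2 is strongly resolved only by its own two vertices, so the
    complement of a strong resolving set consists of pairwise disjoint k-sets
    and has at most n / k elements.  Conversely the complement of any such
    family F is strong resolving: if U and V are disjoint members of F,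
    exchanging one point of V for a point outside both gives a set W that meets
    V, so that W is not in F, and is adjacent to U but not to V. *)

Section DiameterTwo.

Variables (T : finType) (e : rel T).
Hypothesis e_sym : symmetric e.
Hypothesis e_diam2 :
  forall u v, u != v -> ~~ e u v -> exists2 w, e u w & e w v.
Implicit Types (u v w : T) (S : {set T}).

Lemma dist_diam2 u v : dist e u v = if u == v then 0 else if e u v then 1 else 2.
Proof.
case: eqVneq => [->|neq_uv]; first exact: dist0.
have [le2 conn] : dist e u v <= (if e u v then 1 else 2) /\ connect e u v.
  case: ifPn => [euv | /(e_diam2 neq_uv)[w euw ewv]].
    by rewrite connect1 //; split=> //; apply: (@dist_min T e u [:: v]); rewrite /= euv.
  rewrite (connect_trans (connect1 euw) (connect1 ewv)); split=> //.
  by apply: (@dist_min T e u [:: w; v]); rewrite /= euw ewv.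
(* For the lower bound, take a walk realising the distance: length 0 would force [u = v], and length
   1 an edge. *)
case/has_walkP: (dist_walk conn) => p [ep lp sp].
apply/eqP; rewrite eqn_leq le2 -sp /=.
case: p {sp} ep lp => [_ /= eq_uv | x [|y p] /=]; first by rewrite eq_uv eqxx in neq_uv.
  by rewrite andbT => eux <-; rewrite eux.
by case: ifP.
Qed.

(** All three distances are 1 or 2, so either defining equation can only read 2 = 1 + 1. *)
Lemma strongly_resolves_diam2 w u v :
  u != v -> w != u -> w != v ->
  strongly_resolves e w u v = e u v && (e u w (+) e v w).
Proof.
move=> neq_uv neq_wu neq_wv.
rewrite /strongly_resolves !dist_diam2 (negPf neq_uv) (eq_sym v u) (negPf neq_uv).
rewrite (eq_sym u w) (eq_sym v w) (negPf neq_wu) (negPf neq_wv) (e_sym v u).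
by case: (e u v); case: (e u w); case: (e v w).
Qed.

(** A pair that meets [S] is resolved by its own member in [S], so only pairs outside [S] impose a
    condition. *)
Lemma strong_resolving_setP_diam2 S :
  reflect (forall u v, u \notin S -> v \notin S -> u != v ->
             e u v /\ exists2 w, w \in S & e u w (+) e v w)
          (strong_resolving_set e S).
Proof.
apply: (iffP forallP) => [resS u v uS vS neq_uv | resS u].
  move/forallP/(_ v)/implyP/(_ neq_uv)/existsP: (resS u) => [w /andP[wS]].
  rewrite strongly_resolves_diam2 //; first by case/andP=> euv ?; split=> //; exists w.
    by apply: contraNneq uS => <-.
  by apply: contraNneq vS => <-.
apply/forallP => v; apply/implyP => neq_uv; apply/existsP.
have [uS|uS] := boolP (u \in S).
  by exists u; rewrite uS /strongly_resolves dist0 addn0 eqxx.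
have [vS|vS] := boolP (v \in S).
  by exists v; rewrite vS /strongly_resolves dist0 addn0 eqxx orbT.
have [euv [w wS ew]] := resS u v uS vS neq_uv.
exists w; rewrite wS strongly_resolves_diam2 ?euv //.
  by apply: contraNneq uS => <-.
by apply: contraNneq vS => <-.
Qed.

End DiameterTwo.

Lemma subset_of_card (T : finType) (A : {set T}) m :
  m <= #|A| -> exists2 B : {set T}, B \subset A & #|B| = m.
Proof.
rewrite -bin_gt0 -cards_draws => /card_gt0P[B].
by rewrite inE => /andP[sBA /eqP cB]; exists B.
Qed.

Section Kneser.

Variables n k : nat.
Implicit Types (A B C : kneser_vertex n k) (F : {set kneser_vertex n k}).

Lemma card_kneser_vertex : #|{: kneser_vertex n k}| = 'C(n, k).
Proof.
rewrite card_sig -[in RHS](card_ord n) -cardsT -cards_draws.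
by apply: eq_card => A; rewrite !inE ?subsetT.
Qed.

Lemma kneser_sym : symmetric (kneser n k).
Proof. by move=> A B; rewrite /kneser disjoint_sym. Qed.

Lemma kneser_irr : 0 < k -> irreflexive (kneser n k).
Proof.
move=> k_gt0 A; apply/negP; rewrite /kneser -setI_eq0 setIid => /eqP A0.
by have /eqP := valP A; rewrite A0 cards0; lia.
Qed.

Lemma card_setC_vertexU A B : #|~: (val A :|: val B)| = n - (k.*2 - #|val A :&: val B|).
Proof.
have := cardsC (val A :|: val B); rewrite card_ord.
have := cardsUI (val A) (val B); rewrite (eqP (valP A)) (eqP (valP B)); lia.
Qed.

Lemma kneser_diam2 A B : 3 * k - 1 <= n -> ~~ kneser n k A B ->
  exists2 C, kneser n k A C & kneser n k C B.
Proof.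
move=> hn; rewrite /kneser -setI_eq0 -card_gt0 => AB_gt0.
have [|C sC /eqP cC] := @subset_of_card _ (~: (val A :|: val B)) k.
  (* The union has at most 2k - 1 points, so at least n - (2k - 1) >= k remain: exactly the bound
     [hn]. *)
  by rewrite card_setC_vertexU; lia.
move: sC; rewrite setCU subsetI -!disjoints_subset => /andP[CA CB].
by exists (exist _ C cC); rewrite // disjoint_sym.
Qed.

Lemma card_disjoint_family F : 0 < k ->
  {in F &, forall A B, A != B -> kneser n k A B} -> #|F| <= n %/ k.
Proof.
move=> k_gt0 disjF; rewrite leq_divRL //.
have trivF : trivIset [set val A | A in F].
  apply/trivIsetP => _ _ /imsetP[A AF ->] /imsetP[B BF ->] neqAB.
  by apply: disjF => //; apply: contraNneq neqAB => ->.
rewrite -[X in _ <= X]card_ord.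
apply: leq_trans (max_card (mem (cover [set val A | A in F]))).
(* [trivIset] is by definition the equality of the sum of the cardinals with the cardinal of the
   cover. *)
move/eqP: trivF => <-; rewrite big_imset /=; last by move=> A B _ _ /val_inj.
by rewrite (eq_bigr (fun=> k)) ?sum_nat_const // => A _; apply/eqP/(valP A).
Qed.

(** The block consists of the points i * k + j with j < k; all lie below n because (i + 1) * k <= (n
    %/ k) * k <= n. *)
Lemma card_ord_block i : i < n %/ k -> #|[set x : 'I_n | x %/ k == i]| == k.
Proof.
move=> lt_i; have k_gt0 : 0 < k by case: k lt_i.
have lt_n (j : 'I_k) : i * k + j < n.
  have := leq_mul2r k i.+1 (n %/ k); have := leq_divM n k.
  have := ltn_ord j; lia.
pose f j := Ordinal (lt_n j).
have f_inj : injective f by move=> j1 j2 /(congr1 val) /= /addnI /val_inj.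
suff -> : [set x : 'I_n | x %/ k == i] = f @: 'I_k by rewrite card_imset ?card_ord.
apply/setP => x; rewrite inE; apply/eqP/imsetP => [def_i | [j _ ->]].
  exists (Ordinal (ltn_pmod x k_gt0)) => //; apply: val_inj => /=.
  by rewrite -def_i -divn_eq.
by rewrite /= divnMDl // divn_small ?addn0.
Qed.

Lemma disjoint_family_exists : 0 < k ->
  exists2 F : {set kneser_vertex n k}, #|F| = n %/ k
    & {in F &, forall A B, A != B -> kneser n k A B}.
Proof.
move=> k_gt0.
pose b (i : 'I_(n %/ k)) : kneser_vertex n k :=
  exist _ [set x : 'I_n | x %/ k == i] (card_ord_block (ltn_ord i)).
have b_disj i j : i != j -> kneser n k (b i) (b j).
  move=> neq_ij; rewrite /kneser -setI_eq0; apply/eqP/setP => x; rewrite !inE.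
  by apply: contra_neqF neq_ij => /andP[/eqP xi /eqP xj]; apply: val_inj; rewrite /= -xi.
exists (b @: 'I_(n %/ k)).
  (* Equal blocks with distinct indices would give a vertex adjacent to itself. *)
  rewrite card_imset ?card_ord // => i j eq_b; apply/eqP/negPn/negP => /b_disj.
  by rewrite eq_b kneser_irr.
move=> _ _ /imsetP[i _ ->] /imsetP[j _ ->] neq_b; apply: b_disj.
by apply: contraNneq neq_b => ->.
Qed.

Lemma kneser_exchange A B : 1 < k -> 3 * k - 1 <= n -> kneser n k A B ->
  exists C, [/\ C != B, ~~ kneser n k B C & kneser n k A C].
Proof.
move=> k_gt1 hn AB.
have cA := eqP (valP A); have cB := eqP (valP B).
(* Disjoint [A] and [B] leave n - 2k >= k - 1 >= 1 points. *)
have /card_gt0P[x xN] : 0 < #|~: (val A :|: val B)|.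
  by rewrite card_setC_vertexU; lia.
move: xN; rewrite !inE negb_or => /andP[xA xB].
have /card_gt0P[y yB] : 0 < #|val B| by rewrite cB; lia.
(* Since k >= 2, a point [z] of [B] survives the exchange of [y] for [x] and witnesses that [B]
   meets the new set. *)
have /card_gt0P[z zB] : 0 < #|val B :\ y|.
  by have := cardsD1 y (val B); rewrite yB cB; lia.
have cC : #|x |: (val B :\ y)| == k.
  have := cardsD1 y (val B); rewrite yB cB cardsU1 !inE (negPf xB) andbF; lia.
exists (exist _ (x |: (val B :\ y)) cC); split.
- by apply: contraNneq xB => <-; rewrite /= setU11.
- rewrite /kneser /=; apply/pred0Pn; exists z; rewrite /= in_setU zB orbT andbT.
  by case/setD1P: zB.
- rewrite kneser_sym /kneser disjoints_subset subUset sub1set inE xA /=.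
  apply: subset_trans (subD1set _ _) _.
  by rewrite -disjoints_subset disjoint_sym.
Qed.

End Kneser.

Theorem theorem6 (n k : nat) (hk : 2 <= k) (hn : 3 * k - 1 <= n) :
  strong_metric_dim (kneser n k) = 'C(n, k) - n %/ k.
Proof.
have k_gt0 : 0 < k := ltnW hk.
have resP S := strong_resolving_setP_diam2 (@kneser_sym n k)
  (fun A B _ => @kneser_diam2 n k A B hn) S.
have [[S /resP resS cS] minS] := strong_metric_dimP (kneser n k).
apply/eqP; rewrite eqn_leq; apply/andP; split.
  have [F cF disjF] := disjoint_family_exists n k_gt0.
  (* The right-hand side becomes the size of the complement of [F], the strong resolving set to be
     tested. *)
  rewrite -cF -card_kneser_vertex -(cardsC F) addKn.
  apply: minS; apply/resP => A B; rewrite !inE !negbK => AF BF neqAB.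
  have AB := disjF _ _ AF BF neqAB; split=> //.
  have [C [neqCB BC AC]] := kneser_exchange hk hn AB.
  exists C; last by rewrite AC (negPf BC).
  by rewrite inE; apply: contra BC => CF; apply: disjF; rewrite // eq_sym.
(* The lower bound amounts to the complement of a minimum [S] having at most [n %/ k] elements. *)
rewrite -cS leq_subLR -card_kneser_vertex -(cardsC S) addnC leq_add2r.
apply: card_disjoint_family => // A B; rewrite !inE => AS BS neqAB.
by have [] := resS A B AS BS neqAB.
Qed.
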